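(* Fix a real number $\epsilon$ with $0<\epsilon<\frac{3\sqrt{2}}{4}-1$. Let $H$ be the graph whose vertices are the points of ${\mathbb R}^2$, with an edge between every pair of points whose Euclidean distance lies in the closed interval $[1,1+\epsilon]$. Then $6\le \chi(H)\le 7$.
   Context: $\chi(H)$ denotes the chromatic number of $H$: the least number of colours in a colouring of the vertices (here, all points of ${\mathbb R}^2$, with no regularity assumption on the colour classes) such that adjacent vertices receive different colours. *)

(* Defs.v *)
From mathcomp Require Import all_boot all_order all_algebra.
From mathcomp Require Import reals.
Set Implicit Arguments.
Unset Strict Implicit.
Unset Printing Implicit Defensive.
Import Order.TTheory GRing.Theory Num.Theory.
Local Open Scope ring_scope.

(* Graphs on an arbitrary, possibly infinite, vertex type V are given by their
   adjacency relation. *)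
Definition proper_coloring (V C : Type) (adj : rel V) (c : V -> C) : Prop :=
  forall x y : V, adj x y -> c x <> c y.

Definition colorable (V : Type) (adj : rel V) (k : nat) : Prop :=
  exists c : V -> 'I_k, proper_coloring adj c.

(* A relation rather than a function, since a graph on an infinite vertex set
   need not have a finite chromatic number. *)
Definition is_chromatic_number (V : Type) (adj : rel V) (k : nat) : Prop :=
  colorable adj k /\ forall m : nat, colorable adj m -> (k <= m)%N.

(* The norm that MathComp-Analysis puts on 'rV[R]_n is the sup norm, hence this
   explicit Euclidean distance. *)
Definition edist (R : realType) (n : nat) (x y : 'rV[R]_n) : R :=
  Num.sqrt (\sum_(i < n) (x 0 i - y 0 i) ^+ 2).

Definition interval_distance_graph (R : realType) (eps : R) : rel 'rV[R]_2 :=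
  fun x y => 1 <= edist x y <= 1 + eps.

(* Main.v *)
Require Import Defs.
From mathcomp Require Import all_boot all_order all_algebra.
From mathcomp Require Import reals boolp zify ring lra.
Import Order.TTheory GRing.Theory Num.Theory.
Local Open Scope ring_scope.

(** Lower bound: call a chain of points of one colour with steps at most [eps]
    monochromatic. Along it the distance to the starting point cannot jump over
    the forbidden interval [1, 1 + eps], so it stays below 1
    ([chained_bounded]). Colour classes therefore behave like maps with regions
    of diameter less than 1, and as in the proof that dimension two needs
    covers of order three, Sperner's lemma produces points o, y, z of three
    different colours arbitrarily close to each other ([three_colors_meet]).
    The circle of radius 1 + eps/2 about o is forbidden to these three colours.
    It needs three more ([circle_three_colors]): any two nearby points on it
    have a common neighbour, the rotation of one of them by 60 degrees about
    the centre, so if only two colours occurred then nearby points would agree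
    and the circle would be monochromatic, although a point and its rotation
    are adjacent. Hence there are at least six colours.

    Upper bound: pave the plane with half-open bricks of width 4/5 and height
    3/5, whose diagonal 1 is not attained, shift every row by
    12/5 bricks with respect to the row below, and colour each row periodically
    with seven colours. Bricks of the same colour are then more than
    sqrt (6/5) > 1 + eps apart ([same_color_distance]), with room to spare for
    the given range of eps. *)

(** * Euclidean distance in the plane *)

Section Plane.
Context {R : realType}.
Implicit Types (o x y z : 'rV[R]_2) (r t u : R).

Definition pt (a b : R) : 'rV[R]_2 := \row_j (if j == 0 then a else b).

Lemma pt0 a b : pt a b 0 0 = a. Proof. by rewrite mxE. Qed.

Lemma pt1 a b : pt a b 0 1 = b. Proof. by rewrite mxE. Qed.

Lemma edistE x y :
  edist x y = Num.sqrt ((x 0 0 - y 0 0) ^+ 2 + (x 0 1 - y 0 1) ^+ 2).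
Proof.
rewrite /edist !big_ord_recl big_ord0 addr0.
by have -> : lift ord0 ord0 = 1 :> 'I_2 by apply: val_inj.
Qed.

Lemma edist_ge0 x y : 0 <= edist x y. Proof. exact: sqrtr_ge0. Qed.

Lemma edistC x y : edist x y = edist y x.
Proof. by rewrite !edistE; congr Num.sqrt; ring. Qed.

Lemma edistxx x : edist x x = 0.
Proof. by rewrite edistE !subrr expr0n /= addr0 sqrtr0. Qed.

Lemma sqr_edist x y :
  edist x y ^+ 2 = (x 0 0 - y 0 0) ^+ 2 + (x 0 1 - y 0 1) ^+ 2.
Proof. by rewrite edistE sqr_sqrtr // addr_ge0 ?sqr_ge0. Qed.

Lemma edist_le x y r : 0 <= r ->
  (edist x y <= r) = ((x 0 0 - y 0 0) ^+ 2 + (x 0 1 - y 0 1) ^+ 2 <= r ^+ 2).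
Proof. by move=> r0; rewrite -sqr_edist ler_sqr ?nnegrE ?edist_ge0. Qed.

Lemma edist_eq x y r : 0 <= r ->
  (x 0 0 - y 0 0) ^+ 2 + (x 0 1 - y 0 1) ^+ 2 = r ^+ 2 -> edist x y = r.
Proof. by move=> r0 e; rewrite edistE e sqrtr_sqr ger0_norm. Qed.

Lemma edist_triangle y x z : edist x z <= edist x y + edist y z.
Proof.
rewrite edist_le ?addr_ge0 ?edist_ge0 // [leRHS]sqrrD !sqr_edist.
have := sqr_edist x y; have := sqr_edist y z.
have := edist_ge0 x y; have := edist_ge0 y z.
move: (edist x y) (edist y z) => d e.
set a := x 0 0 - y 0 0; set b := x 0 1 - y 0 1.
set a' := y 0 0 - z 0 0; set b' := y 0 1 - z 0 1.
have -> : x 0 0 - z 0 0 = a + a' by rewrite /a /a'; ring.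
have -> : x 0 1 - z 0 1 = b + b' by rewrite /b /b'; ring.
move: a b a' b' => a b a' b' e0 d0 eE dE.
suff : a * a' + b * b' <= d * e by lra.
apply: le_trans (ler_norm _) _.
rewrite -ler_sqr ?nnegrE ?mulr_ge0 // real_normK ?num_real //.
rewrite exprMn dE eE -subr_ge0.
rewrite (_ : _ - _ = (a * b' - b * a') ^+ 2) ?sqr_ge0 //; ring.
Qed.

Lemma le_edist0 x y : `|x 0 0 - y 0 0| <= edist x y.
Proof.
rewrite -ler_sqr ?nnegrE ?edist_ge0 // real_normK ?num_real // sqr_edist.
by rewrite lerDl sqr_ge0.
Qed.

Lemma le_edist1 x y : `|x 0 1 - y 0 1| <= edist x y.
Proof.
rewrite -ler_sqr ?nnegrE ?edist_ge0 // real_normK ?num_real // sqr_edist.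
by rewrite lerDr sqr_ge0.
Qed.

(** * Circles and rotation by 60 degrees *)

Let s3 : R := Num.sqrt 3.

Lemma s3sq : s3 ^+ 2 = 3. Proof. by rewrite sqr_sqrtr. Qed.

Lemma s3_gt0 : 0 < s3. Proof. by rewrite sqrtr_gt0. Qed.

Definition rot60 o x : 'rV[R]_2 :=
  pt (o 0 0 + ((x 0 0 - o 0 0) - s3 * (x 0 1 - o 0 1)) / 2)
     (o 0 1 + (s3 * (x 0 0 - o 0 0) + (x 0 1 - o 0 1)) / 2).

(** The centre, a point and its rotation form an equilateral triangle. *)
Lemma edist_rot60 o x : edist x (rot60 o x) = edist o x.
Proof.
apply: edist_eq (edist_ge0 _ _) _; rewrite sqr_edist !pt0 !pt1.
by field: s3sq.
Qed.

Lemma edist_center_rot60 o x : edist o (rot60 o x) = edist o x.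
Proof.
apply: edist_eq (edist_ge0 _ _) _; rewrite sqr_edist !pt0 !pt1.
by field: s3sq.
Qed.

(** The rational parametrization of the circle by the tangent of the half angle
    gives, without trigonometry, an explicitly Lipschitz path from a point to
    its rotation by 60 degrees, which is reached at tan 30 = 1 / sqrt 3. *)
Definition arc o r t : 'rV[R]_2 :=
  pt (o 0 0 + r * ((1 - t ^+ 2) / (1 + t ^+ 2)))
     (o 0 1 + r * (2 * t / (1 + t ^+ 2))).

Let den_gt0 t : 0 < 1 + t ^+ 2.
Proof. by rewrite ltr_pwDl ?sqr_ge0. Qed.

Let den_neq0 t : 1 + t ^+ 2 != 0.
Proof. exact: lt0r_neq0. Qed.

Lemma edist_center_arc o r t : 0 <= r -> edist o (arc o r t) = r.
Proof.
move=> r0; apply: edist_eq => //; rewrite !pt0 !pt1.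
by field; exact: den_neq0.
Qed.

(** The squared chord is exactly
    (2 r (t - u))^2 / ((1 + t^2) (1 + u^2)). *)
Lemma edist_arc_le o r t u : 0 <= r ->
  edist (arc o r t) (arc o r u) <= 2 * r * `|t - u|.
Proof.
move=> r0; rewrite edist_le ?mulr_ge0 // !pt0 !pt1.
rewrite [leLHS](_ : _ =
  (2 * r * `|t - u|) ^+ 2 / ((1 + t ^+ 2) * (1 + u ^+ 2))).
  rewrite ler_pdivrMr ?mulr_gt0 // ler_peMr ?sqr_ge0 //.
  by rewrite mulr_ege1 // lerDl sqr_ge0.
rewrite exprMn real_normK ?num_real //.
by field; rewrite !den_neq0.
Qed.

Lemma rot60_arc0 o r : rot60 o (arc o r 0) = arc o r s3^-1.
Proof.
have s0 : s3 != 0 := lt0r_neq0 s3_gt0.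
have e : 1 + s3^-1 ^+ 2 = 4 / 3 by rewrite exprVn s3sq; field.
rewrite /rot60 /arc !pt0 !pt1 e exprVn s3sq; congr pt; first by field.
by field: s3sq.
Qed.

(** * Colours on a circle *)

Section Circle.
Context {C : eqType} (eps : R) (c : 'rV[R]_2 -> C).
Hypothesis cP : proper_coloring (interval_distance_graph eps) c.

Lemma proper_neq x y : 1 <= edist x y <= 1 + eps -> c x != c y.
Proof. by move=> xy; apply/eqP/cP. Qed.

(** Two points of the circle at distance at most [eta] are both adjacent to the
    rotation of either one, so a two-coloured circle would be locally constant
    in colour; following an arc of 60 degrees by steps of length at most [eta]
    then contradicts the adjacency of its end points. *)
Lemma circle_three_colors o r : 1 < r < 1 + eps ->
  exists x y z, [/\ edist o x = r, edist o y = r, edist o z = r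
                  & uniq [:: c x; c y; c z]].
Proof.
case/andP=> r1 re.
have r0 : 0 <= r by lra.
pose eta := Num.min (r - 1) (1 + eps - r).
have eta0 : 0 < eta by rewrite lt_min; apply/andP; split; lra.
have [eta1 eta2] : eta <= r - 1 /\ eta <= 1 + eps - r.
  by rewrite !ge_min !lexx orbT.
pose N := (Num.truncn (2 * r / (s3 * eta))).+1.
have N0 : (0 : R) < N%:R by rewrite ltr0n.
have seta0 : 0 < s3 * eta by rewrite mulr_gt0 ?s3_gt0.
have NP : 2 * r * (s3 * N%:R)^-1 <= eta.
  have := truncnS_gt (2 * r / (s3 * eta)).
  rewrite -/N ltr_pdivrMr // => h.
  by rewrite ler_pdivrMr ?mulr_gt0 ?s3_gt0 //; lra.
(* N steps lead from parameter 0 to the parameter 1 / sqrt 3 of the rotated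
   point. *)
pose a k := arc o r (k%:R * (s3 * N%:R)^-1).
have [|same] := pselect (exists k, c (a k) != c (a k.+1)).
  case=> k ck; pose z := rot60 o (a k).
  have oa j : edist o (a j) = r by apply: edist_center_arc.
  have oz : edist o z = r by rewrite edist_center_rot60.
  have az : edist (a k) z = r by rewrite edist_rot60.
  have aa : edist (a k) (a k.+1) <= eta.
    apply: le_trans (edist_arc_le _ _ _ _ r0) _.
    rewrite -mulrBl -[k.+1]addn1 natrD opprD addNKr mulN1r normrN gtr0_norm //.
    by rewrite invr_gt0 mulr_gt0 ?s3_gt0.
  have a'a : edist (a k.+1) (a k) <= eta by rewrite edistC.
  have t1 := edist_triangle (a k.+1) (a k) z.
  have t2 := edist_triangle (a k) (a k.+1) z.
  exists (a k), (a k.+1), z; split=> //=.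
  rewrite !inE negb_or ck !proper_neq //.
    by apply/andP; split; lra.
  by apply/andP; split; lra.
have const k : c (a k) = c (a 0%N).
  elim: k => // k <-; apply/esym/eqP; apply: contrapT => /negP h.
  by apply: same; exists k.
have := const N.
have -> : a N = rot60 o (a 0%N).
  rewrite /a mul0r rot60_arc0; congr arc.
  by field; rewrite !lt0r_neq0 ?s3_gt0.
move/eqP; rewrite eq_sym => same0; exfalso; move: same0; apply/negP/proper_neq.
by rewrite edist_rot60 edist_center_arc //; apply/andP; split; lra.
Qed.

(** * Monochromatic chains *)

Inductive chained x : 'rV[R]_2 -> Prop :=
| chained_refl : chained x x
| chained_step y z :
    chained x y -> c y = c z -> edist y z <= eps -> chained x z.

(** A step of length at most [eps], within one colour, from a point at distance
    less than 1 ends at distance less than 1 + eps; if that were at least 1, the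
    end point would be adjacent to the starting point. *)
Lemma chained_bounded x y : chained x y -> c x = c y /\ edist x y < 1.
Proof.
elim=> [|{}y z _ [xy dxy] yz dyz]; first by rewrite edistxx.
have xz : c x = c z by rewrite xy.
split=> //; rewrite ltNge; apply/negP => d1.
have /eqP := xz; apply/negP/proper_neq; rewrite d1 /=.
by have := edist_triangle y x z; lra.
Qed.

End Circle.
End Plane.

(** * Sperner's lemma on a square grid *)

Section Grid.
Context {T : eqType} (a b : T).

Definition rainbow (x y z : T) := uniq [:: x; y; z].

(** The signed indicator of the edges joining label [a] to label [b]; it acts as
    a closed 1-form away from the rainbow triangles. *)
Definition crossing (x y : T) : int :=
  ((x == a) && (y == b))%:R - ((x == b) && (y == a))%:R.

Lemma crossingC x y : crossing x y = - crossing y x.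
Proof. by rewrite /crossing opprB (andbC (y == b)) (andbC (y == a)). Qed.

Lemma crossingxx x : crossing x x = 0.
Proof. by rewrite /crossing andbC subrr. Qed.

(** Of a triangle with a repeated label, one edge has equal ends and the other
    two cancel. *)
Lemma crossing_triangle x y z : ~~ rainbow x y z ->
  crossing x y + crossing y z = crossing x z.
Proof.
rewrite /rainbow /= !inE !andbT !negb_and !negbK.
case/orP=> [/orP[]|] /eqP->.
- by rewrite crossingxx add0r.
- by rewrite crossingxx crossingC addNr.
- by rewrite crossingxx addr0.
Qed.

Lemma crossing_avoid_a x y : x != a -> y != a -> crossing x y = 0.
Proof. by rewrite /crossing => /negPf-> /negPf->; rewrite andbF subrr. Qed.

Lemma crossing_avoid_b x y : x != b -> y != b -> crossing x y = 0.
Proof. by rewrite /crossing => /negPf-> /negPf->; rewrite andbF subrr. Qed.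

Lemma crossing_within x y : a != b -> x \in [:: a; b] -> y \in [:: a; b] ->
  crossing x y = (y == b)%:R - (x == b)%:R.
Proof.
move=> ab; rewrite !inE /crossing => /orP[]/eqP-> /orP[]/eqP->;
by rewrite ?eqxx ?(negPf ab) 1?eq_sym ?(negPf ab).
Qed.

(** Sperner's lemma, with two sides of the triangle of Sperner glued as the right
    and top sides of the square. If no cell contains a rainbow triangle, then by
    Green's theorem the total crossing of a horizontal line is the same for all
    rows, because the vertical sides contribute nothing. But it is 0 on the top
    side, which avoids [a], and telescopes to 1 on the bottom side, which goes
    from [a] to [b] through these two labels only. *)
Lemma sperner_square (N : nat) (L : nat -> nat -> T) : a != b ->
    (forall i, (i <= N)%N -> L i 0%N \in [:: a; b]) ->
    (forall j, (j <= N)%N -> L 0%N j != b) ->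
    (forall j, (j <= N)%N -> L N j != a) ->
    (forall i, (i <= N)%N -> L i N != a) ->
  exists i j, [/\ (i < N)%N, (j < N)%N &
    rainbow (L i j) (L i.+1 j) (L i.+1 j.+1)
    || rainbow (L i j) (L i j.+1) (L i.+1 j.+1)].
Proof.
move=> ab bottom left right top.
apply: contrapT => none.
have square i j : (i < N)%N -> (j < N)%N ->
    crossing (L i j.+1) (L i.+1 j.+1) - crossing (L i j) (L i.+1 j)
    = crossing (L i.+1 j) (L i.+1 j.+1) - crossing (L i j) (L i j.+1).
  move=> iN jN.
  have /norP[t1 t2] : ~~ (rainbow (L i j) (L i.+1 j) (L i.+1 j.+1)
    || rainbow (L i j) (L i j.+1) (L i.+1 j.+1)).
    by apply/negP => r; apply: none; exists i, j.
  move: (crossing_triangle _ _ _ t1) (crossing_triangle _ _ _ t2).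
  by move=> e1 e2; lra.
pose S j := \sum_(0 <= i < N) crossing (L i j) (L i.+1 j).
have Sstep j : (j < N)%N -> S j.+1 = S j.
  move=> jN; apply/eqP; rewrite -subr_eq0 /S -sumrB.
  rewrite (@eq_big_nat _ _ _ _ _ _
    (fun i => crossing (L i.+1 j) (L i.+1 j.+1) - crossing (L i j) (L i j.+1))).
    rewrite (telescope_sumr (fun i => crossing (L i j) (L i j.+1))) //.
    rewrite crossing_avoid_a ?right ?(ltnW jN) //.
    by rewrite crossing_avoid_b ?left ?(ltnW jN) // subrr.
  by move=> i /andP[_ iN]; apply: square.
have SN : S N = 0.
  rewrite /S big_nat big1 // => i /andP[_ iN].
  by rewrite crossing_avoid_a ?top // ltnW.
have Sconst j : (j <= N)%N -> S j = S 0%N.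
  by elim: j => // j IH jN; rewrite Sstep // IH // ltnW.
have S0 : S 0%N = 1.
  rewrite /S (@eq_big_nat _ _ _ _ _ _
    (fun i => (L i.+1 0%N == b)%:R - (L i 0%N == b)%:R)).
    rewrite (telescope_sumr (fun i => (L i 0%N == b)%:R)) //.
    rewrite (negPf (left _ _)) //.
    have := bottom N (leqnn N); rewrite !inE (negPf (right _ _)) //= => ->.
    by rewrite subr0.
  by move=> i /andP[_ iN]; rewrite crossing_within // bottom // ltnW.
by move: SN; rewrite Sconst // S0.
Qed.
End Grid.

(** * Three colours meet, hence six colours *)

Section Lower.
Context {R : realType} {C : eqType} (eps : R) (c : 'rV[R]_2 -> C).
Hypothesis cP : proper_coloring (interval_distance_graph eps) c.

(** Label the vertices of a fine grid on a square of side at least 2 according to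
    the sides from which monochromatic chains reach them. A chain stays within
    distance 1 of its start, so no vertex is reached from both the left and the
    right side, and no vertex of the bottom side from the top; this gives Sperner's
    boundary conditions. Neighbouring vertices of the same colour are reached
    by the same chains, so the three labels of a rainbow triangle come with
    three different colours. *)
Lemma three_colors_meet (d : R) : 0 < d -> d <= eps ->
  exists x y z, [/\ edist x y <= d, edist x z <= d & uniq [:: c x; c y; c z]].
Proof.
move=> d0 de.
pose h := d / 2; have h0 : 0 < h by rewrite divr_gt0.
pose N := (Num.truncn (2 / h)).+1.
have Nh : 2 <= N%:R * h.
  by rewrite -ler_pdivrMr // ltW // truncnS_gt.
pose P (i j : nat) : 'rV[R]_2 := pt (i%:R * h) (j%:R * h).
pose onL x := `[< exists j, chained eps c (P 0%N j) x >].
pose onRT x := `[< (exists j, chained eps c (P N j) x)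
                \/ (exists i, chained eps c (P i N) x) >].
pose label x : option bool :=
  if ~~ onRT x then Some false else if ~~ onL x then Some true else None.
have labelE x y : c x = c y -> edist x y <= d -> label x = label y.
  move=> cxy xyd.
  have xye : edist x y <= eps by apply: le_trans de.
  have yxe : edist y x <= eps by rewrite edistC.
  have st t : chained eps c t x <-> chained eps c t y.
    by split=> h'; apply: chained_step h' _ _.
  have eL : onL x = onL y.
    by apply: asbool_equiv_eq; split=> -[j /st]; exists j.
  have eR : onRT x = onRT y.
    by apply: asbool_equiv_eq;
      split=> -[] [j /st]; [left|right|left|right]; exists j.
  by rewrite /label eL eR.
have close i j k l : (i <= k <= i.+1)%N -> (j <= l <= j.+1)%N ->
    edist (P i j) (P k l) <= d.
  move=> ik jl.
  have near m n : (m <= n <= m.+1)%N -> (m%:R * h - n%:R * h) ^+ 2 <= h ^+ 2.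
    case/andP=> mn; rewrite leq_eqVlt ltnS => /orP[/eqP->|nm].
      by rewrite -mulrBl -[m.+1]addn1 natrD opprD addNKr mulN1r sqrrN.
    have -> : m = n by apply/eqP; rewrite eqn_leq mn.
    by rewrite subrr expr0n sqr_ge0.
  rewrite edist_le ?(ltW d0) // !pt0 !pt1.
  (* The diagonal of a cell has squared length 2 h^2 <= 4 h^2 = d^2. *)
  have -> : d ^+ 2 = h ^+ 2 + h ^+ 2 + 2 * h ^+ 2 by rewrite /h; field.
  apply: ler_wpDr; first by rewrite mulr_ge0 ?sqr_ge0.
  exact: lerD (near _ _ ik) (near _ _ jl).
have distinct i j k l : (i <= k <= i.+1)%N -> (j <= l <= j.+1)%N ->
    label (P i j) != label (P k l) -> c (P i j) != c (P k l).
  move=> ik jl; apply: contraNN => /eqP e; apply/eqP.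
  by apply: labelE => //; apply: close.
have [|||||i [j [_ _]]] :=
  @sperner_square _ (Some false) (Some true) N (fun i j => label (P i j)).
- by [].
- move=> i _; rewrite /label; case: ifPn => // /negPn /asboolP RT.
  case: ifPn => // /negPn /asboolP [j /(chained_bounded _ _ cP) [_ lj]].
  have := le_lt_trans (le_edist0 _ _) lj; rewrite !pt0 mul0r sub0r normrN => li.
  case: RT => -[k /(chained_bounded _ _ cP) [_ lk]].
    have := le_lt_trans (le_edist0 _ _) lk; rewrite !pt0.
    by move: li; rewrite !ltr_norml => /andP[? ?] /andP[? ?]; lra.
  have := le_lt_trans (le_edist1 _ _) lk; rewrite !pt1 mul0r subr0.
  by rewrite ltr_norml => /andP[? ?]; lra.
- move=> j _; rewrite /label; case: ifP => // _; case: ifPn => // /asboolPn.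
  by case; exists j; exact: chained_refl.
- move=> j _; rewrite /label; case: ifPn => [/asboolPn|_]; last by case: ifP.
  by case; left; exists j; exact: chained_refl.
- move=> i _; rewrite /label; case: ifPn => [/asboolPn|_]; last by case: ifP.
  by case; right; exists i; exact: chained_refl.
rewrite /rainbow /= !inE !negb_or !andbT => /orP[]/andP[/andP[xy xz] yz].
- exists (P i j), (P i.+1 j), (P i.+1 j.+1).
  rewrite !close ?leqnn ?leqnSn //= !inE negb_or !distinct // ?leqnn ?leqnSn //.
- exists (P i j), (P i j.+1), (P i.+1 j.+1).
  rewrite !close ?leqnn ?leqnSn //= !inE negb_or !distinct // ?leqnn ?leqnSn //.
Qed.

Lemma six_distinct_colors : 0 < eps -> exists s : seq C, uniq s /\ size s = 6%N.
Proof.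
move=> e0.
have [||o [y [z [oy oz u1]]]] := three_colors_meet (eps / 2); [lra|lra|].
have [|x1 [x2 [x3 [d1 d2 d3 u2]]]] :=
  circle_three_colors _ _ cP o (1 + eps / 2); first by apply/andP; split; lra.
exists ([:: c o; c y; c z] ++ [:: c x1; c x2; c x3]); split=> //.
rewrite cat_uniq u1 u2 andbT /=.
have far p x : edist o p <= eps / 2 -> edist o x = 1 + eps / 2 ->
    c x != c p.
  move=> op ox; apply: (proper_neq _ _ cP).
  have := edist_triangle p o x; have := edist_triangle o x p.
  by rewrite (edistC p x) (edistC x o) => ? ?; apply/andP; split; lra.
have oo : edist o o <= eps / 2 by rewrite edistxx; lra.
by rewrite !inE !(negPf (far _ _ _ _)).
Qed.

End Lower.

Lemma colorable_ge6 (R : realType) (eps : R) (m : nat) : 0 < eps ->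
  colorable (interval_distance_graph eps) m -> (6 <= m)%N.
Proof.
move=> e0 [c /six_distinct_colors /(_ e0) [s [us <-]]].
by rewrite -(card_uniqP us) -[leqRHS]card_ord max_card.
Qed.

(** * A colouring with seven colours *)

Section Upper.
Context {R : realType}.
Implicit Types x y : 'rV[R]_2.

Definition brick_row x : int := Num.floor (x 0 1 / (3 / 5)).

(** The position within a row, in brick widths: row [j] starts [12 / 5 * j] bricks
    to the right of row 0. *)
Definition brick_col x : int :=
  Num.floor (x 0 0 / (4 / 5) - 12 / 5 * (brick_row x)%:~R).

Definition brick_color x : 'I_7 := inord `|(brick_col x %% 7)%Z|.

Lemma brick_colorP x y : brick_color x = brick_color y ->
  exists n : int, brick_col x - brick_col y = n * 7.
Proof.
move/(congr1 val).
have lt7 (k : int) : (`|(k %% 7)%Z| < 7)%N.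
  by rewrite -ltz_nat gez0_abs ?modz_ge0 // ltz_pmod.
rewrite /= !inordK // => e; apply/dvdzP; rewrite -eqz_mod_dvd; apply/eqP.
by rewrite -[LHS]gez0_abs ?modz_ge0 // e gez0_abs ?modz_ge0.
Qed.

Lemma ltr_sqr_outside (a x : R) : 0 <= a -> a < x \/ x < - a ->
  a ^+ 2 < x ^+ 2.
Proof.
move=> a0 ax; rewrite -[ltRHS]real_normK ?num_real //.
rewrite ltr_sqr ?nnegrE ?normr_ge0 // ltr_normr ltrNr.
by apply/orP; case: ax => ->; [left|right].
Qed.

(** The difference vector of two points whose bricks are [m] rows and [7 n]
    sheared columns apart; [f] and [g] are the differences of the relative
    positions inside the bricks. For n = m = 0 it is shorter than the diagonal,
    which is 1. Otherwise a gap separates the bricks: of 2 rows if |m| >= 3; of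
    6 widths if m = 0; of at least 7/5 widths, i.e. 28/25, if |m| = 1, since
    |7 n + 12/5 m| >= 12/5; and of 6/5 widths and one row if |m| = 2, since
    |7 n + 24/5| >= 11/5. *)
Lemma same_color_distance (m n : int) (f g : R) : -1 < f < 1 -> -1 < g < 1 ->
  let d := (4 / 5 * (7 * n%:~R + 12 / 5 * m%:~R + g)) ^+ 2
         + (3 / 5 * (m%:~R + f)) ^+ 2 in
  d < 1 \/ 6 / 5 < d.
Proof.
move=> /andP[f1 f2] /andP[g1 g2] /=.
have nP : [\/ n%:~R = 0 :> R, 1 <= n%:~R :> R | n%:~R <= -1 :> R].
  have [->|[h|h]] : n = 0 \/ (1 <= n) \/ (n <= -1) by lia.
  - by constructor 1.
  - by constructor 2; rewrite (ler_int _ 1).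
  - by constructor 3; rewrite (ler_int _ _ (-1)).
have mP : m%:~R = 0 :> R \/ 3 <= `|m%:~R : R| \/
    [\/ m%:~R = 1 :> R, m%:~R = -1 :> R, m%:~R = 2 :> R | m%:~R = -2 :> R].
  have [->|[h|[->|[->|[->|->]]]]] : m = 0 \/ (3 <= `|m|) \/ m = 1 \/ m = -1
    \/ m = 2 \/ m = -2 by lia.
  - by left.
  - by right; left; rewrite -intr_norm (ler_int _ 3).
  - by right; right; constructor 1.
  - by right; right; constructor 2.
  - by right; right; constructor 3.
  - by right; right; constructor 4.
move: (n%:~R) (m%:~R) nP mP => {n m} n m nP mP.
set dx := 4 / 5 * _; set dy := 3 / 5 * _.
have outside (a x : R) : 0 <= a -> a < x \/ x < - a -> a ^+ 2 < x ^+ 2.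
  exact: ltr_sqr_outside.
have dx0 := sqr_ge0 dx; have dy0 := sqr_ge0 dy.
have cols (a : R) : 6 / 5 <= a ^+ 2 -> 0 <= a -> a < dx \/ dx < - a ->
    6 / 5 < dx ^+ 2 + dy ^+ 2.
  by move=> a2 a0 /(outside _ _ a0); lra.
case: mP => [m0|[m3|m12]].
- case: nP => n0.
  + left; rewrite /dx /dy m0 n0 !mulr0 !add0r !exprMn.
    have sq1 (u : R) : -1 < u -> u < 1 -> u ^+ 2 < 1.
      by move=> u1 u2; rewrite -subr_gt0 -{1}(expr1n _ 2) subr_sqr
        mulr_gt0 //; lra.
    by have := sq1 _ f1 f2; have := sq1 _ g1 g2; lra.
  + by right; apply: (cols 4); [lra|lra|left; rewrite /dx; lra].
  + by right; apply: (cols 4); [lra|lra|right; rewrite /dx; lra].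
- right; have /(outside (6 / 5) dy) : (0 : R) <= 6 / 5 by lra.
  suff : 6 / 5 < dy \/ dy < - (6 / 5) by move=> h /(_ h); lra.
  by move: m3; rewrite ler_normr => /orP[] m3; [left|right]; rewrite /dy; lra.
right.
have [m1|m2] : (m = 1 \/ m = -1) \/ (m = 2 \/ m = -2).
  by case: m12; tauto.
- apply: (cols (28 / 25)); [lra|lra|rewrite /dx].
  by case: m1 => ->; case: nP => n0; first [left; lra | right; lra].
have : (24 / 25 : R) ^+ 2 < dx ^+ 2.
  apply: outside; [lra|rewrite /dx].
  by case: m2 => ->; case: nP => n0; first [left; lra | right; lra].
have : (3 / 5 : R) ^+ 2 < dy ^+ 2.
  apply: outside; [lra|rewrite /dy].
  by case: m2 => ->; first [left; lra | right; lra].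
lra.
Qed.

Lemma brick_color_proper (eps : R) : eps < 1 / 15 ->
  proper_coloring (interval_distance_graph eps) brick_color.
Proof.
move=> e1 x y /andP[d1 d2] /brick_colorP [n en].
pose m := brick_row x - brick_row y.
have /andP[xr1 xr2] := floor_itv (x 0 1 / (3 / 5)).
have /andP[yr1 yr2] := floor_itv (y 0 1 / (3 / 5)).
have /andP[xc1 xc2] := floor_itv (x 0 0 / (4 / 5) - 12 / 5 * (brick_row x)%:~R).
have /andP[yc1 yc2] := floor_itv (y 0 0 / (4 / 5) - 12 / 5 * (brick_row y)%:~R).
rewrite -/(brick_row x) -/(brick_row y) -/(brick_col x) -/(brick_col y)
  !intrD in xr1 xr2 yr1 yr2 xc1 xc2 yc1 yc2.
have enR : (brick_col x)%:~R - (brick_col y)%:~R = n%:~R * 7 :> R.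
  by rewrite -intrB en intrM.
have mR : m%:~R = (brick_row x)%:~R - (brick_row y)%:~R :> R by rewrite intrB.
pose f : R := (x 0 1 - y 0 1) / (3 / 5) - m%:~R.
pose g : R := (x 0 0 - y 0 0) / (4 / 5) - (7 * n%:~R + 12 / 5 * m%:~R).
have fP : -1 < f < 1 by rewrite /f mR; apply/andP; split; lra.
have gP : -1 < g < 1 by rewrite /g mR; apply/andP; split; lra.
have := same_color_distance m n f g fP gP.
rewrite (_ : 4 / 5 * _ = x 0 0 - y 0 0); last by rewrite /g; field.
rewrite (_ : 3 / 5 * _ = x 0 1 - y 0 1); last by rewrite /f; field.
rewrite -sqr_edist; move: (edist x y) d1 d2 => d d1 d2.
have : 1 ^+ 2 <= d ^+ 2 by rewrite ler_sqr ?nnegrE //; lra.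
have : d ^+ 2 <= (16 / 15) ^+ 2 by rewrite ler_sqr ?nnegrE; lra.
by move=> ? ? []; lra.
Qed.

End Upper.

Theorem theorem1 (R : realType) (eps : R)
    (heps0 : 0 < eps) (heps1 : eps < 3 * Num.sqrt 2 / 4 - 1) :
  exists k : nat,
    is_chromatic_number (interval_distance_graph eps) k /\ (6 <= k <= 7)%N.
Proof.
(* 64 / 45 makes the bound on eps equal to 1 / 15. *)
have s2 : Num.sqrt 2 < 64 / 45 :> R.
  rewrite -ltr_sqr ?nnegrE ?sqrtr_ge0 ?divr_ge0 // sqr_sqrtr //; lra.
have c7 : colorable (interval_distance_graph eps) 7.
  by exists brick_color; apply: brick_color_proper; lra.
have exk : exists k, `[< colorable (interval_distance_graph eps) k >].
  by exists 7%N; apply/asboolP.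
case: (ex_minnP exk) => k /asboolP ck kmin.
exists k; split; last by rewrite (colorable_ge6 _ _ _ heps0 ck) // kmin //; apply/asboolP.
by split=> // m cm; apply: kmin; apply/asboolP.
Qed.
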